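(* Let $A\in\mathbb{R}^{m\times n}$, $\mathbf{b}\in\mathbb{R}^m$, $\mathbf{c},\mathbf{d},\boldsymbol{\varphi}\in\mathbb{R}^n$, and let $\Lambda\subseteq\mathbb{R}$ be an interval such that for every $\lambda\in\Lambda$ the linear program $$f_c(\lambda)=\min\{(\mathbf{c}+\lambda\mathbf{d})^t\mathbf{x}\ :\ A\mathbf{x}\le\mathbf{b},\ \mathbf{x}\ge 0\}$$ is feasible and has a finite optimal value. Let $\varepsilon>0$ and, for $\lambda\in\Lambda$, define $$g_c^\varepsilon(\lambda)=\min\{\boldsymbol{\varphi}^t\mathbf{x}\ :\ (\mathbf{c}+\lambda\mathbf{d})^t\mathbf{x}\le f_c(\lambda)+\varepsilon,\ A\mathbf{x}\le\mathbf{b},\ \mathbf{x}\ge 0\},$$ where this minimum is assumed to be finite for every $\lambda\in\Lambda$. Then the function $g_c^\varepsilon:\Lambda\to\mathbb{R}$ is continuous at every $\lambda\in\Lambda$.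
   Context: Vector inequalities are componentwise. Continuity at a point of $\Lambda$ is understood relative to $\Lambda$ (with its subspace topology). *)

(* Defs.v *)
From HB Require Import structures.
From mathcomp Require Import all_boot all_order all_algebra.
From mathcomp Require Import all_classical all_reals all_analysis.
Set Implicit Arguments.
Unset Strict Implicit.
Unset Printing Implicit Defensive.
Import Order.TTheory GRing.Theory Num.Theory.
Import numFieldNormedType.Exports.
Local Open Scope classical_set_scope.
Local Open Scope ring_scope.

Definition le_cV (R : realType) (n : nat) (u v : 'cV[R]_n) : Prop :=
  forall i : 'I_n, u i ord0 <= v i ord0.

Definition dot (R : realType) (n : nat) (u v : 'cV[R]_n) : R :=
  (u^T *m v) ord0 ord0.

(* The value of the problem min {p^t x : x in S}, in the extended reals: +oo
   when S is empty, -oo when the objective is unbounded below on S, and the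
   minimum whenever there is one (opt_value_min). *)
Definition opt_value (R : realType) (n : nat) (p : 'cV[R]_n)
    (S : set 'cV[R]_n) : \bar R :=
  ereal_inf [set (dot p x)%:E | x in S].

Lemma opt_value_min (R : realType) (n : nat) (p : 'cV[R]_n)
    (S : set 'cV[R]_n) (x : 'cV[R]_n) :
  S x -> (forall y, S y -> dot p x <= dot p y) ->
  opt_value p S = (dot p x)%:E.
Proof.
move=> Sx xmin; apply/eqP; rewrite eq_le; apply/andP; split.
  by apply: ereal_inf_lbound; exists x.
by apply: le_ereal_inf_tmp => _ [y Sy <-]; rewrite lee_fin xmin.
Qed.

Definition feasible (R : realType) (m n : nat) (A : 'M[R]_(m, n))
    (b : 'cV[R]_m) : set 'cV[R]_n :=
  [set x | le_cV (A *m x) b /\ le_cV 0 x].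

Definition f_c (R : realType) (m n : nat) (A : 'M[R]_(m, n)) (b : 'cV[R]_m)
    (c d : 'cV[R]_n) (lambda : R) : \bar R :=
  opt_value (c + lambda *: d) (feasible A b).

Definition eps_feasible (R : realType) (m n : nat) (A : 'M[R]_(m, n))
    (b : 'cV[R]_m) (c d : 'cV[R]_n) (eps lambda : R) : set 'cV[R]_n :=
  [set x | ((dot (c + lambda *: d) x)%:E <= f_c A b c d lambda + eps%:E)%E
           /\ feasible A b x].

Definition g_c (R : realType) (m n : nat) (A : 'M[R]_(m, n)) (b : 'cV[R]_m)
    (c d phi : 'cV[R]_n) (eps lambda : R) : \bar R :=
  opt_value phi (eps_feasible A b c d eps lambda).

(* Main.v *)
Require Import Defs.
From HB Require Import structures.
From mathcomp Require Import all_boot all_order all_algebra.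
From mathcomp Require Import all_classical all_reals all_analysis.
From mathcomp Require Import ring lra.
Set Implicit Arguments.
Unset Strict Implicit.
Unset Printing Implicit Defensive.
Import Order.TTheory GRing.Theory Num.Theory.
Import numFieldNormedType.Exports.
Local Open Scope classical_set_scope.
Local Open Scope ring_scope.

(** Write [X] for the feasible polyhedron, [F p] for the infimum of [p] over
    [X], and [G p] for the infimum of [phi] over the [eps]-optimal points of
    [p].  The argument rests on the convexity of [X]; the difficulty is
    that [X], and with it the set of [eps]-optimal points, may be unbounded.

    Because [eps > 0], the constraint [p x <= F p + eps] has a Slater point [y]
    with [p y <= F p + eps / 2].  Sliding a point of [X] slightly towards [y]
    trades a little of [phi] for slack in that constraint.  Hence [G p]
    changes arbitrarily little when the tolerance [eps] is slightly tightened
    ([tightened_near_optimal]) or slightly relaxed ([relaxed_near_optimal]).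

    It remains to compare the constraint at two costs by means of such a change
    of tolerance.  Let [p0] be the cost at the parameter [lambda0], [p1] the
    cost at another parameter of [Lambda], and move from [p0] to
    [ps = (1 - s) p0 + s p1].  By concavity [F ps >= (1 - s) F p0 + s F p1], so
    a fixed point that is [eps - eta]-optimal for [p0] is [eps]-optimal for [ps]
    once [s] is small: this bounds [G ps] from above.  Conversely a point [x]
    that is [eps]-optimal for [ps] may be arbitrarily far away, but
    [p1 x >= F p1] holds whatever [x] is, and subtracting [s] times this
    inequality shows that [x] is [eps + eta]-optimal for [p0], for all small [s]
    uniformly in [x]: this bounds [G ps] from below.  So [G] is continuous along
    the segment ([near_opt_value_segment]), and applying this with [p1] taken
    once on each side of [lambda0] gives the theorem. *)

(** * Linear objectives over a set *)

Lemma dot_mixl (R : realType) (n : nat) (p q x : 'cV[R]_n) (s : R) :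
  dot ((1 - s) *: p + s *: q) x = (1 - s) * dot p x + s * dot q x.
Proof. by rewrite /dot linearD !linearZ /= mulmxDl -!scalemxAl !mxE. Qed.

Lemma dot_mixr (R : realType) (n : nat) (p x y : 'cV[R]_n) (t : R) :
  dot p ((1 - t) *: x + t *: y) = (1 - t) * dot p x + t * dot p y.
Proof. by rewrite /dot mulmxDr -!scalemxAr !mxE. Qed.

Section OptValue.
Variables (R : realType) (n : nat) (p : 'cV[R]_n) (S : set 'cV[R]_n).
Hypothesis p_fin : opt_value p S \is a fin_num.

Lemma opt_value_le (x : 'cV[R]_n) : S x -> fine (opt_value p S) <= dot p x.
Proof.
move=> Sx; rewrite -lee_fin fineK //.
by apply: ereal_inf_lbound; exists x.
Qed.

Lemma le_opt_value (r : R) :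
  (forall x, S x -> r <= dot p x) -> r <= fine (opt_value p S).
Proof.
move=> r_lb; rewrite -lee_fin fineK //.
by apply: le_ereal_inf_tmp => _ [x Sx <-]; rewrite lee_fin r_lb.
Qed.

Lemma opt_value_approx (eta : R) : 0 < eta ->
  exists2 x, S x & dot p x <= fine (opt_value p S) + eta.
Proof.
move=> eta_gt0.
have [_ [x Sx <-] ltx] := lb_ereal_inf_adherent eta_gt0 p_fin.
exists x => //; apply: ltW; rewrite -lte_fin.
by rewrite EFinD fineK.
Qed.

End OptValue.

Definition convex_pts (R : realType) (n : nat) (X : set 'cV[R]_n) : Prop :=
  forall (t : R) x y, 0 <= t <= 1 -> X x -> X y -> X ((1 - t) *: x + t *: y).

Lemma feasible_convex (R : realType) (m n : nat) (A : 'M[R]_(m, n))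
    (b : 'cV[R]_m) : convex_pts (feasible A b).
Proof.
move=> t x y /andP[t0 t1] [Ax x0] [Ay y0]; split=> i.
  rewrite mulmxDr -!scalemxAr.
  move: (Ax i) (Ay i); rewrite !mxE => Axi Ayi.
  nra.
move: (x0 i) (y0 i); rewrite !mxE => xi yi.
nra.
Qed.

Definition near_optimal (R : realType) (n : nat) (X : set 'cV[R]_n)
    (eps : R) (p : 'cV[R]_n) : set 'cV[R]_n :=
  [set x | ((dot p x)%:E <= opt_value p X + eps%:E)%E /\ X x].

Lemma near_optimalP (R : realType) (n : nat) (X : set 'cV[R]_n)
    (eps : R) (p x : 'cV[R]_n) : opt_value p X \is a fin_num ->
  near_optimal X eps p x <-> X x /\ dot p x <= fine (opt_value p X) + eps.
Proof.
move=> p_fin; rewrite /near_optimal /= -{1}(fineK p_fin) -EFinD lee_fin.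
by split=> -[].
Qed.

(** The bound [t <= 1] makes [t] usable as the weight of a convex combination. *)
Lemma small_step (R : realType) (K e : R) : 0 < e ->
  exists2 t, 0 < t <= 1 & t * K <= e.
Proof.
move=> e_gt0; have K1 : 0 < `|K| + e + 1 by have := normr_ge0 K; lra.
exists (e / (`|K| + e + 1)).
  rewrite divr_gt0 //= ler_pdivrMr // mul1r.
  by have := normr_ge0 K; lra.
rewrite mulrAC ler_pdivrMr // ler_pM2l //.
by have := ler_norm K; lra.
Qed.

Lemma near0_mul_le (R : realType) (K e : R) : 0 < e ->
  \forall s \near (0 : R), s * K <= e.
Proof.
move=> e_gt0.
have sK0 : (fun s : R => s * K) @ (0 : R) --> (0 : R).
  by rewrite -[X in _ --> X](mul0r K); apply: cvgMr_tmp.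
have /cvgrPdist_le/(_ e e_gt0) := sK0.
apply: filterS => s; rewrite sub0r normrN.
exact: le_trans (ler_norm _).
Qed.

(** * Changing the tolerance and the cost *)

Section NearOptimalValue.
Variables (R : realType) (n : nat) (X : set 'cV[R]_n) (phi : 'cV[R]_n).
Variable eps : R.
Hypotheses (X_convex : convex_pts X) (eps_gt0 : 0 < eps).

Local Notation F p := (fine (opt_value p X)).
Local Notation G p := (fine (opt_value phi (near_optimal X eps p))).

(** A nearly [phi]-minimal point is moved a little towards a Slater point. *)
Lemma tightened_near_optimal (p : 'cV[R]_n) (e : R) :
  opt_value p X \is a fin_num ->
  opt_value phi (near_optimal X eps p) \is a fin_num -> 0 < e ->
  exists eta x, [/\ 0 < eta, X x, dot p x <= F p + eps - eta &
                   dot phi x <= G p + e].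
Proof.
move=> p_fin g_fin e_gt0; have e2 : 0 < e / 2 by lra.
have eps2 : 0 < eps / 2 by exact: divr_gt0.
have [y Xy py] := opt_value_approx p_fin eps2.
have [x /near_optimalP-/(_ p_fin)[Xx px] phix] :=
  opt_value_approx g_fin e2.
have [t /andP[t0 t1] tK] := small_step (dot phi y - dot phi x) e2.
(* Moving by [t] gains [t] times the slack [eps / 2] of [y]. *)
exists (t * (eps / 2)), ((1 - t) *: x + t *: y).
split; first exact: mulr_gt0.
- by apply: X_convex; rewrite // ltW.
- rewrite dot_mixr.
  have : (1 - t) * dot p x <= (1 - t) * (F p + eps).
    by rewrite ler_wpM2l // subr_ge0.
  have : t * dot p y <= t * (F p + eps / 2) by rewrite ler_pM2l.
  lra.
- rewrite dot_mixr; lra.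
Qed.

(** A point [x] violating the tolerance by at most [eta = t * (eps / 2)] becomes
    [eps]-optimal after a step [t] towards a Slater point, and [t] can be fixed
    before [x] is known. *)
Lemma relaxed_near_optimal (p : 'cV[R]_n) (e : R) :
  opt_value p X \is a fin_num ->
  opt_value phi (near_optimal X eps p) \is a fin_num -> 0 < e ->
  exists2 eta, 0 < eta & forall x, X x -> dot p x <= F p + eps + eta ->
    G p - e <= dot phi x.
Proof.
move=> p_fin g_fin e_gt0; have eps2 : 0 < eps / 2 by exact: divr_gt0.
have e2 : 0 < e / 2 by lra.
have [y Xy py] := opt_value_approx p_fin eps2.
have [t /andP[t0 t1] tK] := small_step (dot phi y - G p + e) e2.
exists (t * (eps / 2)); first exact: mulr_gt0.
move=> x Xx px.
have xt_opt : near_optimal X eps p ((1 - t) *: x + t *: y).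
  apply/near_optimalP => //; split; first by apply: X_convex; rewrite // ltW.
  rewrite dot_mixr.
  have tt : 0 <= t * t * eps by rewrite !mulr_ge0 ?ltW.
  have pxt : (1 - t) * dot p x <= (1 - t) * (F p + eps + t * (eps / 2)).
    by rewrite ler_wpM2l // subr_ge0.
  have pyt : t * dot p y <= t * (F p + eps / 2) by rewrite ler_pM2l.
  nra.
have := opt_value_le g_fin xt_opt; rewrite dot_mixr => Gle.
rewrite leNgt; apply/negP => phix.
have : (1 - t) * dot phi x <= (1 - t) * (G p - e).
  by rewrite ler_wpM2l ?subr_ge0 // ltW.
nra.
Qed.

(** The second endpoint [p1] provides two lower bounds that hold at any distance:
    [F p1 <= p1 x] on all of [X], which turns [eps]-optimality for [ps] into
    [(eps + eta)]-optimality for [p0] uniformly in [x], and the concavity bound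
    on [F ps], which keeps a fixed point with slack at [p0] [eps]-optimal at
    [ps].  The cost [ps] is tied to [s] by an equation so that any other form of
    the same vector can be supplied. *)
Lemma near_opt_value_segment (p0 p1 : 'cV[R]_n) (e : R) :
  opt_value p0 X \is a fin_num -> opt_value p1 X \is a fin_num ->
  opt_value phi (near_optimal X eps p0) \is a fin_num -> 0 < e ->
  \forall s \near (0 : R), 0 <= s ->
    forall ps, ps = (1 - s) *: p0 + s *: p1 ->
    opt_value ps X \is a fin_num ->
    opt_value phi (near_optimal X eps ps) \is a fin_num ->
    `|G p0 - G ps| <= e.
Proof.
move=> p0_fin p1_fin g0_fin e_gt0.
have [eta1 [x1 [eta1_gt0 Xx1 p0x1 phix1]]] :=
  tightened_near_optimal p0_fin g0_fin e_gt0.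
have [eta2 eta2_gt0 relax] := relaxed_near_optimal p0_fin g0_fin e_gt0.
have eta22 : 0 < eta2 / 2 by lra.
have [z Xz p0z] := opt_value_approx p0_fin eta22.
near=> s; move=> s_ge0 ps psE ps_fin gs_fin.
have s_lt1 : s < 1.
  suff : s * 1 <= 1 / 2 by lra.
  by near: s; apply: near0_mul_le; lra.
(* [sK1] and [sK2] are the conditions on [s] under which the upper and the
   lower bound on [G ps] go through, solved for the terms that carry [s]. *)
have sK1 : s * (dot p1 x1 - F p1 - eps + eta1) <= eta1.
  by near: s; exact: near0_mul_le.
have sK2 : s * (dot p1 z - F p1 + eps + eta2 / 2) <= eta2 / 2.
  by near: s; exact: near0_mul_le.
have r_gt0 : 0 < 1 - s by rewrite subr_gt0.
have F_concave : (1 - s) * F p0 + s * F p1 <= F ps.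
  apply: le_opt_value => // x Xx; rewrite psE dot_mixl.
  by apply: lerD; apply: ler_wpM2l; rewrite ?opt_value_le // ltW.
rewrite ler_distlC; apply/andP; split.
- apply: le_opt_value => // x /near_optimalP-/(_ ps_fin)[Xx psx].
  apply: relax => //.
  have Fz := opt_value_le ps_fin Xz.
  have sF1 : s * F p1 <= s * dot p1 x by rewrite ler_wpM2l // opt_value_le.
  have rz : (1 - s) * dot p0 z <= (1 - s) * (F p0 + eta2 / 2).
    by rewrite ler_pM2l.
  move: psx Fz; rewrite psE !dot_mixl => psx Fz.
  rewrite -(ler_pM2l r_gt0).
  nra.
- apply: (le_trans _ phix1); apply: opt_value_le => //.
  apply/near_optimalP => //; split=> //; rewrite [in leLHS]psE dot_mixl.
  have rx1 : (1 - s) * dot p0 x1 <= (1 - s) * (F p0 + eps - eta1).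
    by rewrite ler_pM2l.
  nra.
Unshelve. all: by end_near. Qed.

End NearOptimalValue.

(** * The parametric program *)

Section Parametric.
Variables (R : realType) (m n : nat) (A : 'M[R]_(m, n)) (b : 'cV[R]_m).
Variables (c d phi : 'cV[R]_n) (Lambda : set R) (eps : R).
Hypothesis f_finite : forall l, Lambda l -> f_c A b c d l \is a fin_num.
Hypothesis eps_gt0 : 0 < eps.
Hypothesis g_finite :
  forall l, Lambda l -> g_c A b c d phi eps l \is a fin_num.

Local Notation G l := (fine (g_c A b c d phi eps l)).

(** The sign condition says that [l] lies on the same side of [l0] as [l1]. *)
Lemma g_c_near_towards (l0 l1 e : R) :
  Lambda l0 -> Lambda l1 -> l1 != l0 -> 0 < e ->
  \forall l \near l0, Lambda l -> 0 <= (l - l0) / (l1 - l0) ->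
    `|G l0 - G l| <= e.
Proof.
move=> L0 L1 l10 e_gt0; pose s (l : R) := (l - l0) / (l1 - l0).
have l10' : l1 - l0 != 0 by rewrite subr_eq0.
have s_cvg : s @ l0 --> (0 : R).
  rewrite -[X in _ --> X](mul0r (l1 - l0)^-1) -[X in X * _](subrr l0).
  by apply: cvgMr_tmp; apply: cvgB; [exact: cvg_id|exact: cvg_cst].
have /s_cvg near0 := near_opt_value_segment
  (feasible_convex (A := A) (b := b)) eps_gt0
  (f_finite L0) (f_finite L1) (g_finite L0) e_gt0.
apply: (@filterS _ (nbhs l0) _ _ _ _ near0) => l /= near_s Ll s_ge0.
have ps : c + l *: d = (1 - s l) *: (c + l0 *: d) + s l *: (c + l1 *: d).
  apply/matrixP => i j; rewrite !mxE /s; field.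
  exact: l10'.
exact: near_s s_ge0 _ ps (f_finite Ll) (g_finite Ll).
Qed.

Lemma g_c_near (l0 e : R) : Lambda l0 -> 0 < e ->
  \forall l \near l0, Lambda l -> `|G l0 - G l| <= e.
Proof.
move=> L0 e_gt0.
have right_near : \forall l \near l0, Lambda l -> l0 < l -> `|G l0 - G l| <= e.
  have [[l1 L1 lt01]|no_l1] := pselect (exists2 l1, Lambda l1 & l0 < l1).
    have l10 : l1 != l0 by rewrite gt_eqF.
    apply: filterS (g_c_near_towards L0 L1 l10 e_gt0) => l near_l Ll lt0.
    by apply: near_l => //; rewrite divr_ge0 // subr_ge0 ltW.
  by near=> l; move=> Ll lt0; case: no_l1; exists l.
have left_near : \forall l \near l0, Lambda l -> l < l0 -> `|G l0 - G l| <= e.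
  have [[l1 L1 lt10]|no_l1] := pselect (exists2 l1, Lambda l1 & l1 < l0).
    have l10 : l1 != l0 by rewrite lt_eqF.
    apply: filterS (g_c_near_towards L0 L1 l10 e_gt0) => l near_l Ll lt0.
    apply: near_l => //; rewrite -mulrNN -invrN !opprB.
    by rewrite divr_ge0 // subr_ge0 ltW.
  by near=> l; move=> Ll lt0; case: no_l1; exists l.
apply: filterS2 right_near left_near => l right_l left_l Ll.
have [lt0|lt0|<-] := ltgtP l l0; [exact: left_l|exact: right_l|].
by rewrite subrr normr0 ltW.
Unshelve. all: by end_near. Qed.

End Parametric.

Theorem theorem2 (R : realType) (m n : nat) (A : 'M[R]_(m, n))
    (b : 'cV[R]_m) (c d phi : 'cV[R]_n) (Lambda : set R)
    (Lambda_itv : is_interval Lambda)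
    (f_feasible : forall lambda : R, Lambda lambda -> feasible A b !=set0)
    (f_finite : forall lambda : R, Lambda lambda ->
       f_c A b c d lambda \is a fin_num)
    (eps : R) (eps_gt0 : 0 < eps)
    (g_finite : forall lambda : R, Lambda lambda ->
       g_c A b c d phi eps lambda \is a fin_num) :
  {within Lambda, continuous (fun lambda : R =>
     fine (g_c A b c d phi eps lambda))}.
Proof.
apply/subspace_continuousP => l0 L0; apply/cvgrPdist_le => e e_gt0.
exact: g_c_near.
Qed.
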